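(* Suppose $\|X\|^2$ has a continuous distribution with probability density function $h(\cdot)$, and there exist constants $\alpha>1$ and $C_\alpha>0$ such that $t^{-\alpha}h(t)\to C_\alpha$ as $t\to 0$ ($t>0$). Then, for each slice $k\in\{1,\ldots,K\}$, as $n\to\infty$, $$\bar{x}_k-E\{\vec{X}\mid Y=k\}=O_p(n^{-1/2}).$$
   Context: Let $p>1$. $X$ is a random vector in $\mathbb{R}^p$ with an elliptically symmetric distribution which, as in the paper, is taken to have true location $\mu=0$ and true scatter matrix $\Sigma=I_p$ (so $X$ has density of the form $f(\|x\|^2)$); $\vec{X}=X/\|X\|$. $Y$ is discrete with finite support $\{1,\ldots,K\}$, $K\ge2$. $(y_i,x_i)$, $i=1,\ldots,n$, are independent copies of $(Y,X)$. For a positive definite $\Sigma$, $\|v\|_\Sigma^2=v^\top\Sigma^{-1}v$. Estimators of location and scatter (Tyler): $\hat\mu^{(0)}$ is the vector of coordinatewise sample medians of the $x_i$; starting from it (and an initial positive definite scatter matrix), iterate $$\hat\Sigma^{(m+1)}\propto n^{-1}\sum_{i=1}^n\frac{(x_i-\hat\mu^{(m)})(x_i-\hat\mu^{(m)})^\top}{\|x_i-\hat\mu^{(m)}\|^2_{\hat\Sigma^{(m)}}},$$ $$\hat\mu^{(m+1)}=\Big(n^{-1}\sum_{i=1}^n\frac{1}{\|x_i-\hat\mu^{(m)}\|_{\hat\Sigma^{(m+1)}}}\Big)^{-1}\Big(n^{-1}\sum_{i=1}^n\frac{x_i}{\|x_i-\hat\mu^{(m)}\|_{\hat\Sigma^{(m+1)}}}\Big),$$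 with scatter matrices normalized to have trace $p$, until convergence; the limit is $(\hat\mu,\hat\Sigma)$. (One may alternatively keep $\hat\mu^{(m)}=\hat\mu^{(0)}$ fixed for all $m$.) The paper takes as known, from Tyler (1987), that these estimators are $\sqrt n$-consistent: $\hat\mu=O_p(n^{-1/2})$ and $\|\hat\Sigma-I_p\|=O_p(n^{-1/2})$. The estimated contour projected predictors are $\vec{x}_i=\hat\Sigma^{-1/2}(x_i-\hat\mu)/\|x_i-\hat\mu\|_{\hat\Sigma}$. Put $z_{ik}=1$ if $y_i=k$ and $z_{ik}=0$ otherwise, $n_k=\sum_{i=1}^n z_{ik}$, and $\bar{x}_k=n_k^{-1}\sum_{i=1}^n\vec{x}_iz_{ik}$. *)

(* Defs.v *)
From HB Require Import structures.
From mathcomp Require Import all_boot all_order all_algebra.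
From mathcomp Require Import all_classical all_reals all_analysis.

Set Implicit Arguments.
Unset Strict Implicit.
Unset Printing Implicit Defensive.

Import Order.TTheory GRing.Theory Num.Theory.
Import numFieldNormedType.Exports.

Local Open Scope classical_set_scope.
Local Open Scope ring_scope.

Section lebesgue_tuple.
Context {R : realType}.

Definition tcons n (xt : measurableTypeR R * n.-tuple R) : n.+1.-tuple R :=
  [tuple of xt.1 :: xt.2].

Lemma measurable_tcons n : measurable_fun setT (@tcons n).
Proof.
exact: (@measurable_cons _ _ _ R fst n snd measurable_fst measurable_snd).
Qed.

Section step.
Variables (n : nat) (mu : {sigma_finite_measure set (n.-tuple R) -> \bar R}).

Definition lebesgue_tupleS : set (n.+1.-tuple R) -> \bar R :=
  pushforward (@lebesgue_measure R \x mu)%E (@tcons n).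

Let m : {measure set (n.+1.-tuple R) -> \bar R} :=
  measure_function_pushforward__canonical__measure_function_Measure
    (@lebesgue_measure R \x mu)%E (@measurable_tcons n).

HB.instance Definition _ := isMeasure.Build _ _ _ lebesgue_tupleS
  (measure0 m) (measure_ge0 m) (@measure_semi_sigma_additive _ _ _ m).

Let tuncons (t : n.+1.-tuple R) : measurableTypeR R * n.-tuple R :=
  (thead t, [tuple of behead t]).

Let lebesgue_tupleS_sigma_finite : sigma_finite setT lebesgue_tupleS.
Proof.
have /sigma_finiteP[F [FT ndF Foo]] := sigma_finiteT (@lebesgue_measure R).
have /sigma_finiteP[G [GT ndG Goo]] := sigma_finiteT mu.
have tK : cancel (@tcons n) tuncons.
  by move=> [x t]; congr pair => //; exact/val_inj.
have mtuncons : measurable_fun setT tuncons.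
  apply: measurable_fun_pair; [exact: measurable_tnth|exact: measurable_behead].
exists (fun k => tuncons @^-1` (F k `*` G k)).
  rewrite -preimage_bigcup (_ : \bigcup_k _ = setT) ?preimage_setT//.
  apply/seteqP; split=> // -[a t] _.
  have [[i _ Fa] [j _ Gt]] : (\bigcup_i F i) a /\ (\bigcup_i G i) t.
    by rewrite -FT -GT.
  exists (maxn i j) => //; split=> /=.
    by move: a Fa; exact/subsetPset/ndF/leq_maxl.
  by move: t Gt; exact/subsetPset/ndG/leq_maxr.
move=> k; have [mF Fk] := Foo k; have [mG Gk] := Goo k; split.
  by rewrite -[X in measurable X]setTI; apply: mtuncons => //; exact: measurableX.
rewrite /lebesgue_tupleS /pushforward (_ : _ @^-1` _ = F k `*` G k).
  by rewrite product_measure1E// lte_mul_pinfty// ge0_fin_numE.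
by rewrite -comp_preimage (_ : tuncons \o _ = id) ?preimage_id//; exact/funext.
Qed.

HB.instance Definition _ := Measure_isSigmaFinite.Build _ _ _ lebesgue_tupleS
  lebesgue_tupleS_sigma_finite.

End step.

(* n-dimensional Lebesgue measure, as an iterated product measure. *)
Fixpoint lebesgue_tuple n : {sigma_finite_measure set (n.-tuple R) -> \bar R} :=
  if n is n'.+1 then lebesgue_tupleS (lebesgue_tuple n')
  else \d_([tuple] : 0.-tuple R).

End lebesgue_tuple.

Section probability_vocabulary.
Context {d : measure_display} {T : measurableType d} {R : realType}.
Variable P : probability T R.

Definition has_density {d'} {U : measurableType d'} (mu : set U -> \bar R)
    (Z : T -> U) (g : U -> R) : Prop :=
  [/\ measurable_fun setT g, forall u, 0 <= g u &
      forall A, measurable A ->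
        P (Z @^-1` A) = (\int[mu]_(u in A) (g u)%:E)%E].

Definition independent_copies {d'} {U : measurableType d'}
    (Z : T -> U) (W : nat -> T -> U) : Prop :=
  (forall i A, measurable A -> P (W i @^-1` A) = P (Z @^-1` A)) /\
  (forall (J : seq nat) (A : nat -> set U), uniq J ->
    (forall i, measurable (A i)) ->
    P (\bigcap_(i in [set` J]) (W i @^-1` A i)) =
    (\prod_(i <- J) P (W i @^-1` A i))%E).

(* The outer measure P^* is used because the events below are not assumed to
   be measurable; P^* coincides with P on measurable events. *)
Definition with_high_probability (E : nat -> set T) : Prop :=
  (P^* (~` E n))%mu @[n --> \oo] --> (0 : \bar R).

(* On column vectors this is the Euclidean norm, whereas `|A| on matrices is
   the sup norm. *)
Definition frobenius_norm {m n} (A : 'M[R]_(m, n)) : R :=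
  Num.sqrt (\sum_i \sum_j A i j ^+ 2).

(* Z n = O_p(r n) *)
Definition bigO_prob {a b} (Z : nat -> T -> 'M[R]_(a, b)) (r : nat -> R) : Prop :=
  forall e : R, 0 < e -> exists M : R, \forall n \near \oo,
    ((P^* [set w | (M * r n < frobenius_norm (Z n w))%R])%mu <= e%:E)%E.

Definition conditional_mean {p} (V : T -> 'cV[R]_p) (E : set T) : 'cV[R]_p :=
  \col_j ((\int[P]_(w in E) V w j 0)%R / fine (P E)).

End probability_vocabulary.

Section contour_projection.
Context {R : realType} {p : nat}.

Definition tuple_col (t : p.-tuple R) : 'cV[R]_p := \col_j tnth t j.

Definition posdef (S : 'M[R]_p) : Prop :=
  S^T = S /\ forall v : 'cV[R]_p, v != 0 -> 0 < (v^T *m S *m v) 0 0.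

Definition scatter_norm (S : 'M[R]_p) (v : 'cV[R]_p) : R :=
  Num.sqrt ((v^T *m invmx S *m v) 0 0).

(* The symmetric positive definite root; 0 when S is not positive definite. *)
Definition inv_sqrtmx (S : 'M[R]_p) : 'M[R]_p :=
  xget 0 [set B | posdef B /\ B *m B = invmx S].

Definition direction (v : 'cV[R]_p) : 'cV[R]_p := (frobenius_norm v)^-1 *: v.

Definition projected_predictor (mu : 'cV[R]_p) (S : 'M[R]_p) (x : 'cV[R]_p) :
    'cV[R]_p :=
  (scatter_norm S (x - mu))^-1 *: (inv_sqrtmx S *m (x - mu)).

(* For even sample sizes, the midpoint of the two central order statistics. *)
Definition median (s : seq R) : R :=
  let t := sort <=%O s in
  (nth 0 t (size s).-1./2 + nth 0 t (size s)./2) / 2.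

Section tyler.
(* Terms whose denominator vanishes count as 0, since 0^-1 = 0. *)
Variables (n : nat) (x : nat -> 'cV[R]_p).

Definition coordinatewise_median : 'cV[R]_p :=
  \col_j median [seq x i j 0 | i <- iota 0 n].

Definition tyler_scatter (mu : 'cV[R]_p) (S : 'M[R]_p) : 'M[R]_p :=
  let W := n%:R^-1 *:
    \sum_(i < n) (scatter_norm S (x i - mu) ^+ 2)^-1 *:
      ((x i - mu) *m (x i - mu)^T) in
  (p%:R / \tr W) *: W.

Definition tyler_location (mu : 'cV[R]_p) (S : 'M[R]_p) : 'cV[R]_p :=
  (n%:R^-1 * \sum_(i < n) (scatter_norm S (x i - mu))^-1)^-1 *:
    (n%:R^-1 *: \sum_(i < n) (scatter_norm S (x i - mu))^-1 *: x i).

(* update = false keeps the location at the coordinatewise median. The scale of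
   S0 is immaterial since every later scatter matrix is normalized to trace p. *)
Fixpoint tyler_iter (update : bool) (S0 : 'M[R]_p) (m : nat) :
    'cV[R]_p * 'M[R]_p :=
  if m is m'.+1 then
    let mu := (tyler_iter update S0 m').1 in
    let S' := tyler_scatter mu (tyler_iter update S0 m').2 in
    (if update then tyler_location mu S' else mu, S')
  else (coordinatewise_median, S0).

Definition tyler_limit (update : bool) (S0 : 'M[R]_p)
    (mu : 'cV[R]_p) (S : 'M[R]_p) : Prop :=
  (tyler_iter update S0 m).1 @[m --> \oo] --> mu /\
  (tyler_iter update S0 m).2 @[m --> \oo] --> S.

End tyler.

Definition slice_mean (n : nat) (y : nat -> nat) (x : nat -> 'cV[R]_p)
    (mu : 'cV[R]_p) (S : 'M[R]_p) (k : nat) : 'cV[R]_p :=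
  (\sum_(i < n) (y i == k)%:R)^-1 *:
    \sum_(i < n) (y i == k)%:R *: projected_predictor mu S (x i).

End contour_projection.

(* Main.v *)
Require Import Defs.
From HB Require Import structures.
From mathcomp Require Import all_boot all_order all_algebra.
From mathcomp Require Import all_classical all_reals all_analysis.
From mathcomp Require Import measurable_realfun.
From mathcomp Require Import ring lra.

Set Implicit Arguments.
Unset Strict Implicit.
Unset Printing Implicit Defensive.

Import Order.TTheory GRing.Theory Num.Theory.
Import numFieldNormedType.Exports.

Local Open Scope classical_set_scope.
Local Open Scope ring_scope.

(** Write z_i for the indicator of y_i = k, n_k for the sum of the z_i, B for
    inv_sqrtmx of the estimated scatter, u_i for the direction of x_i and v_i
    for its estimated contour projection, and m for E(u | Y = k).  Then

      n_k (slice mean - m) = sum_i z_i (v_i - u_i) + sum_i z_i (u_i - m).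

    The second sum consists of bounded centred independent variables, so it is
    O_p(sqrt n) by Chebyshev's inequality (chebyshev_copies); the same
    inequality makes n_k at least n P(Y = k) / 2 with high probability.

    For the first sum, the square norm of the scatter matrix S at x - mu is
    |B (x - mu)|^2, so that v_i is the direction of B (x_i - mu).  Normalizing
    is Lipschitz with constant 2 / |x| at x (direction_lipschitz), whence

      |v_i - u_i| <= 2 (|B - 1| + |B| |mu| / |x_i|).

    Both |B - 1| and |mu| are O_p(n^(-1/2)), and it remains to see that the
    average of the 1 / |x_i| is O_p(1).  By Markov's inequality this follows
    from E(1 / |X|) < oo, which is where the behaviour of the density h of
    |X|^2 at 0 enters: it makes h bounded near 0, so
    P(1 / |X| >= t) = P(0 < |X|^2 <= t^-2) is O(t^-2)
    (inverse_sqrt_integrable).  Having a density also makes |X|^2 vanish with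
    probability 0, so that almost surely no x_i is 0.

    Passing from the rate of S to that of B takes some care, since inv_sqrtmx S
    is meaningful only once S^-1 is known to have a positive definite square
    root.  The limit S of the iteration is symmetric because all iterates but
    the initial one are (tyler_limit_sym), and for a symmetric S near 1
    the root exists by a fixed point argument (sqrt_near1); any such root is at
    least as close to 1 as its square is (frobenius_sqrt_near1), which transfers
    the rate without any discussion of uniqueness.

    The estimators are not assumed measurable, so the exceptional events are
    handled through the outer measure, which is monotone and subadditive. *)

(** * Frobenius norm and directions *)

Section frobenius.
Context {R : realType}.

(** Lagrange's identity: the difference of the two sides is half a sum of
    squares. *)
Lemma cauchy_schwarz_sum (I : finType) (a b : I -> R) :
  (\sum_i a i * b i) ^+ 2 <= (\sum_i a i ^+ 2) * (\sum_i b i ^+ 2).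
Proof.
have lagrange : \sum_i \sum_j (a i * b j - a j * b i) ^+ 2 =
    2 * ((\sum_i a i ^+ 2) * (\sum_i b i ^+ 2) - (\sum_i a i * b i) ^+ 2).
  rewrite expr2 !big_distrlr /= mulrBr !mulr_natl !mulr2n.
  rewrite [X in _ + X - _]exchange_big -!big_split -sumrB /=.
  apply: eq_bigr => i _; rewrite -!big_split -sumrB /=.
  by apply: eq_bigr => j _; ring.
rewrite -subr_ge0 -(pmulr_rge0 _ (ltr0n R 2)) -lagrange.
by apply: sumr_ge0 => i _; apply: sumr_ge0 => j _; exact: sqr_ge0.
Qed.

Section shape.
Context {m n : nat}.
Implicit Types A B : 'M[R]_(m, n).

Lemma frobenius_ge0 A : 0 <= frobenius_norm A.
Proof. exact: sqrtr_ge0. Qed.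

Lemma sqr_frobenius A : frobenius_norm A ^+ 2 = \sum_i \sum_j A i j ^+ 2.
Proof.
by rewrite sqr_sqrtr//; do 2!apply: sumr_ge0 => ? _; exact: sqr_ge0.
Qed.

Lemma sqr_frobenius_pair A :
  frobenius_norm A ^+ 2 = \sum_(k : 'I_m * 'I_n) A k.1 k.2 ^+ 2.
Proof. by rewrite sqr_frobenius pair_bigA. Qed.

Lemma frobeniusD A B :
  frobenius_norm (A + B) <= frobenius_norm A + frobenius_norm B.
Proof.
rewrite -(@ler_pXn2r _ 2)// ?nnegrE ?addr_ge0 ?frobenius_ge0// sqrrD.
rewrite !sqr_frobenius_pair.
under eq_bigr do rewrite mxE sqrrD.
rewrite big_split /= lerD2r big_split /= lerD2l sumrMnl lerMn2r /=.
apply: le_trans (ler_norm _) _.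
rewrite -(@ler_pXn2r _ 2)// ?nnegrE ?mulr_ge0 ?frobenius_ge0//.
by rewrite real_normK ?num_real// exprMn !sqr_frobenius_pair cauchy_schwarz_sum.
Qed.

Lemma frobeniusZ (c : R) A : frobenius_norm (c *: A) = `|c| * frobenius_norm A.
Proof.
apply: (pexpIrn (n := 2)); rewrite ?nnegrE ?mulr_ge0 ?frobenius_ge0//.
rewrite exprMn real_normK ?num_real// !sqr_frobenius_pair mulr_sumr.
by apply: eq_bigr => k _; rewrite mxE exprMn.
Qed.

Lemma frobeniusN A : frobenius_norm (- A) = frobenius_norm A.
Proof. by rewrite -scaleN1r frobeniusZ normrN1 mul1r. Qed.

Lemma frobenius_distC A B : frobenius_norm (A - B) = frobenius_norm (B - A).
Proof. by rewrite -frobeniusN opprB. Qed.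

Lemma frobenius0 : frobenius_norm (0 : 'M[R]_(m, n)) = 0.
Proof. by rewrite -[0 in LHS](scale0r 0) frobeniusZ normr0 mul0r. Qed.

Lemma frobenius_sum (I : Type) (r : seq I) (F : I -> 'M[R]_(m, n)) :
  frobenius_norm (\sum_(i <- r) F i) <= \sum_(i <- r) frobenius_norm (F i).
Proof.
elim/big_ind2 : _ => [|A a B b Aa Bb|//]; first by rewrite frobenius0.
exact: le_trans (frobeniusD _ _) (lerD Aa Bb).
Qed.

Lemma entry_le_frobenius A i j : `|A i j| <= frobenius_norm A.
Proof.
rewrite -(@ler_pXn2r _ 2)// ?nnegrE ?frobenius_ge0//.
rewrite real_normK ?num_real// sqr_frobenius_pair (bigD1 (i, j))//=.
by rewrite lerDl sumr_ge0// => k _; exact: sqr_ge0.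
Qed.

Lemma frobenius_eq0 A : (frobenius_norm A == 0) = (A == 0).
Proof.
apply/eqP/eqP => [A0|->]; last exact: frobenius0.
apply/matrixP => i j; rewrite mxE; apply/eqP.
by rewrite -normr_le0 -A0 entry_le_frobenius.
Qed.

Lemma frobenius_gt0 A : (0 < frobenius_norm A) = (A != 0).
Proof. by rewrite lt_def frobenius_eq0 frobenius_ge0 andbT. Qed.

Lemma frobenius_dist_norm A B :
  `|frobenius_norm A - frobenius_norm B| <= frobenius_norm (A - B).
Proof.
have /= AB := frobeniusD (A - B) B; have /= BA := frobeniusD (B - A) A.
rewrite subrK in AB; rewrite subrK frobenius_distC in BA.
by rewrite ler_norml; apply/andP; split; lra.
Qed.

End shape.

Lemma frobeniusM m n q (A : 'M[R]_(m, n)) (B : 'M[R]_(n, q)) :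
  frobenius_norm (A *m B) <= frobenius_norm A * frobenius_norm B.
Proof.
rewrite -(@ler_pXn2r _ 2)// ?nnegrE ?mulr_ge0 ?frobenius_ge0//.
rewrite exprMn !sqr_frobenius mulr_suml; apply: ler_sum => i _.
rewrite exchange_big mulr_sumr; apply: ler_sum => j _.
by rewrite mxE cauchy_schwarz_sum.
Qed.

Lemma trmx_mul_self m (v : 'cV[R]_m) :
  (v^T *m v) 0 0 = frobenius_norm v ^+ 2.
Proof.
rewrite sqr_frobenius mxE; apply: eq_bigr => i _.
by rewrite big_ord1 mxE expr2.
Qed.

Lemma frobenius_direction m (v : 'cV[R]_m) :
  v != 0 -> frobenius_norm (direction v) = 1.
Proof.
rewrite -frobenius_gt0 => v0.
by rewrite frobeniusZ ger0_norm ?invr_ge0 ?ltW// mulVf ?gt_eqF.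
Qed.

Lemma frobenius_direction_le1 m (v : 'cV[R]_m) :
  frobenius_norm (direction v) <= 1.
Proof.
have [->|/frobenius_direction->//] := eqVneq v 0.
by rewrite /direction scaler0 frobenius0.
Qed.

(** The bound holds for every [a], however far from [b] and even for [a = 0],
    where [direction 0 = 0]: multiplied by |b|, the difference is
    (|b| - |a|) (a / |a|) + (a - b), and each term has norm at most |a - b|. *)
Lemma direction_lipschitz m (a b : 'cV[R]_m) : b != 0 ->
  frobenius_norm (direction a - direction b) <=
    2 * (frobenius_norm (a - b) / frobenius_norm b).
Proof.
move=> b0; have nb0 : 0 < frobenius_norm b by rewrite frobenius_gt0.
have [->|a0] := eqVneq a 0.
  rewrite /direction scaler0 !sub0r !frobeniusN divff ?gt_eqF//.
  by have := frobenius_direction_le1 b; rewrite /direction; lra.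
rewrite mulrA ler_pdivlMr// mulrC -[X in X * _]gtr0_norm// -frobeniusZ.
have -> : frobenius_norm b *: (direction a - direction b) =
    (frobenius_norm b - frobenius_norm a) *: direction a + (a - b).
  rewrite scalerBr scalerBl /direction [X in X = _]addrC.
  rewrite !scalerA !divff ?gt_eqF ?frobenius_gt0// !scale1r.
  by rewrite addrA subrK addrC.
apply: le_trans (frobeniusD _ _) _; rewrite frobeniusZ frobenius_direction//.
have := frobenius_dist_norm b a; rewrite frobenius_distC; lra.
Qed.

End frobenius.

(** * Matrices near the identity and their square roots *)

(** Banach's fixed point theorem is applied to matrices below; it requires
    completeness and the norm to be joined in one structure. *)
HB.instance Definition _ (R : realType) m n := Complete.on 'M[R]_(m, n).

Section matrices_near_identity.
Context {R : realType}.

Lemma entry_le_mx_norm m n (A : 'M[R]_(m, n)) i j : `|A i j| <= `|A|.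
Proof.
by rewrite [`|A|]mx_normrE; exact: (le_bigmax _ (fun k => `|A k.1 k.2|) (i, j)).
Qed.

Lemma mx_norm_le m n (A : 'M[R]_(m, n)) (r : R) :
  0 <= r -> (forall i j, `|A i j| <= r) -> `|A| <= r.
Proof.
by move=> r0 Ar; rewrite [`|A|]mx_normrE; apply/bigmax_leP; split=> // -[i j] _; exact: Ar.
Qed.

Lemma mx_normM m n q (A : 'M[R]_(m, n)) (B : 'M[R]_(n, q)) :
  `|A *m B| <= n%:R * (`|A| * `|B|).
Proof.
apply: mx_norm_le => [|i j]; first by rewrite !mulr_ge0.
rewrite mxE (le_trans (ler_norm_sum _ _ _))//.
rewrite -[X in X%:R]card_ord mulr_natl -sumr_const.
apply: ler_sum => k _; rewrite normrM.
by apply: ler_pM => //; exact: entry_le_mx_norm.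
Qed.

Lemma frobenius_le_mx_norm n (A : 'M[R]_n) : frobenius_norm A <= n%:R * `|A|.
Proof.
rewrite -(@ler_pXn2r _ 2)// ?nnegrE ?mulr_ge0 ?frobenius_ge0//.
rewrite sqr_frobenius exprMn expr2 -mulrA mulr_natl -[X in _ *+ X]card_ord.
rewrite -sumr_const; apply: ler_sum => i _.
rewrite mulr_natl -[X in _ *+ X]card_ord -sumr_const; apply: ler_sum => j _.
by rewrite -real_normK ?num_real// ler_pXn2r ?nnegrE// entry_le_mx_norm.
Qed.

Lemma mx_norm_le_frobenius m n (A : 'M[R]_(m, n)) : `|A| <= frobenius_norm A.
Proof.
by apply: mx_norm_le; [exact: frobenius_ge0|exact: entry_le_frobenius].
Qed.

Lemma closed_symmetric n : closed [set S : 'M[R]_n | S^T = S].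
Proof.
have -> : [set S : 'M[R]_n | S^T = S] =
    \bigcap_(k : 'I_n * 'I_n) [set S | S k.2 k.1 - S k.1 k.2 = 0].
  apply/seteqP; split=> [S /= ST [i j] _ /=|S /= ST].
    by rewrite -[in X in X - _]ST mxE subrr.
  by apply/matrixP => i j; rewrite mxE; apply/eqP; rewrite -subr_eq0 (ST (i, j)).
apply: closed_bigI => -[i j] _ /=.
apply: (@preimage_closed _ _ (fun S : 'M[R]_n => S j i - S i j) [set 0]).
  have c k l : continuous (fun S : 'M[R]_n => S k l) by exact: coord_continuous.
  by move=> S _; exact: (cvgB (c j i S) (c i j S)).
exact: closed_eq.
Qed.

(** v^T S v differs from |v|^2 by v^T (S - 1) v, at most |v|^2 / 2. *)
Lemma posdef_near1 n (S : 'M[R]_n) :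
  S^T = S -> frobenius_norm (S - 1%:M) <= 2^-1 -> posdef S.
Proof.
move=> ST S1; split=> // v; rewrite -frobenius_gt0 => v0.
have -> : v^T *m S *m v = v^T *m v + v^T *m (S - 1%:M) *m v.
  by rewrite mulmxBr mulmxBl mulmx1 addrC subrK.
rewrite mxE trmx_mul_self.
have := entry_le_frobenius (v^T *m (S - 1%:M) *m v) 0 0.
have vT : frobenius_norm v^T = frobenius_norm v.
  by rewrite /frobenius_norm exchange_big/=; under eq_bigr do under eq_bigr do rewrite mxE.
have := frobeniusM (v^T *m (S - 1%:M)) v.
have := frobeniusM v^T (S - 1%:M); rewrite vT ler_norml.
nra.
Qed.

Lemma posdef_unitmx n (S : 'M[R]_n) : posdef S -> S \in unitmx.
Proof.
move=> [ST Spos]; rewrite -row_free_unit -kermx_eq0.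
apply/eqP/row_matrixP => i; rewrite row0; apply/eqP/negPn/negP => ki.
have kS : row i (kermx S) *m S = 0 by rewrite -row_mul mulmx_ker row0.
have := Spos (row i (kermx S))^T; rewrite trmxK kS mul0mx mxE ltxx.
by rewrite -[X in _ != X]trmx0 (inj_eq (@trmx_inj _ _ _)) => /(_ ki).
Qed.

(** From S^-1 - 1 = - S^-1 (S - 1), which first bounds |S^-1| by 2 |1| and then
    gives the claim. *)
Lemma frobenius_invmx_near1 n (S : 'M[R]_n) : S \in unitmx ->
  frobenius_norm (S - 1%:M) <= 2^-1 ->
  frobenius_norm (invmx S - 1%:M) <=
    2 * frobenius_norm (1%:M : 'M[R]_n) * frobenius_norm (S - 1%:M).
Proof.
move=> Su S1.
have -> : invmx S - 1%:M = - (invmx S *m (S - 1%:M)).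
  by rewrite mulmxBr mulVmx// mulmx1 opprB.
rewrite frobeniusN; apply: le_trans (frobeniusM _ _) _.
rewrite ler_wpM2r ?frobenius_ge0//.
have : frobenius_norm (invmx S) <= frobenius_norm (1%:M : 'M[R]_n) +
    frobenius_norm (invmx S) * frobenius_norm (S - 1%:M).
  have {1}-> : invmx S = 1%:M - invmx S *m (S - 1%:M).
    by rewrite mulmxBr mulVmx// mulmx1 opprB addrCA subrr addr0.
  by apply: le_trans (frobeniusD _ _) _; rewrite frobeniusN lerD2l frobeniusM.
have := frobenius_ge0 (invmx S); nra.
Qed.

(** A root 1 + C of 1 + E solves 2 C = E - C^2.  The map C |-> (E - C^2) / 2
    preserves the symmetric matrices in a ball of radius 1 / 2n and contracts
    there by 1 / 2; the factor n in the radius compensates for the sup norm of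
    matrices being submultiplicative only up to n. *)
Lemma sqrt_near1 n (E : 'M[R]_n) : E^T = E ->
    `|E| <= (2 * n%:R)^-1 ->
  exists B : 'M[R]_n, posdef B /\ B *m B = 1%:M + E.
Proof.
case: n E => [|n] E ET E1.
  exists 1%:M; split; last by rewrite [LHS]flatmx0 [RHS]flatmx0.
  by apply: posdef_near1; rewrite ?trmx1// subrr frobenius0 invr_ge0.
set r : R := (2 * n.+1%:R)^-1.
have nr : n.+1%:R * r = 2^-1 by rewrite /r invfM mulrCA divff// mulr1.
have r0 : 0 < r by rewrite invr_gt0 mulr_gt0.
pose U : set 'M[R]_n.+1 := [set C | C^T = C /\ `|C| <= r].
pose F (C : 'M[R]_n.+1) := 2^-1 *: (E - C *m C).
have FU : {homo F : C / U C >-> U C}.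
  move=> C [CT Cr]; split; first by rewrite /F linearZ linearB/= trmx_mul CT ET.
  rewrite normrZ gtr0_norm ?invr_gt0//.
  have := ler_normB E (C *m C); have := mx_normM C C.
  move: E1; rewrite -/r; set N := n.+1%:R in nr *; move=> E1 CC EC.
  have : N * (`|C| * `|C|) <= N * (r * r).
    by rewrite ler_wpM2l ?ler0n// ler_pM.
  by rewrite [N * (r * r)]mulrA nr; lra.
have cF : is_contraction (mkfun FU).
  exists (2^-1)%:nng; split; first by rewrite /= invf_lt1 ?ltr1n.
  move=> -[C D] [[CT Cr] [DT Dr]] /=.
  rewrite /F -scalerBr normrZ gtr0_norm ?invr_gt0// ler_pM2l ?invr_gt0//.
  have -> : E - C *m C - (E - D *m D) = - (C *m (C - D) + (C - D) *m D).
    by rewrite mulmxBr mulmxBl; apply/matrixP => i j; rewrite !mxE; ring.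
  rewrite normrN (le_trans (ler_normD _ _))//.
  have := mx_normM C (C - D); have := mx_normM (C - D) D.
  set N := n.+1%:R in nr *; move=> h1 h2.
  have : N * `|C| <= 2^-1 by rewrite -nr ler_wpM2l ?ler0n.
  have : N * `|D| <= 2^-1 by rewrite -nr ler_wpM2l ?ler0n.
  by have := normr_ge0 (C - D); nra.
have clU : closed U.
  apply: closedI; first exact: closed_symmetric.
  apply: (@preimage_closed _ _ (fun C : 'M[R]_n.+1 => `|C|) [set x | x <= r]).
    by move=> C _; exact: norm_continuous.
  exact: closed_le.
have U0 : U !=set0 by exists 0; split; rewrite ?trmx0// normr0 ltW.
have [C [CT Cr] CF] := banach_fixed_point cF clU U0.
exists (1%:M + C); split.
  apply: posdef_near1; first by rewrite linearD/= trmx1 CT.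
  rewrite addrC addKr (le_trans (frobenius_le_mx_norm _))//.
  by rewrite -nr ler_wpM2l ?ler0n.
have : 2 *: C = E - C *m C.
  by rewrite [in LHS]CF /= scalerA divff// scale1r.
rewrite scaler_nat mulr2n => CE; have {CE}EC : C + C + C *m C = E.
  by rewrite CE subrK.
by rewrite mulmxDl !mulmxDr !mulmx1 !mul1mx -EC !addrA.
Qed.

(** With D = B - 1 one has B^2 - 1 = D B + D, and the inner product of D B with
    D is nonnegative, being the sum of the values of the form B at the rows
    of D. *)
Lemma frobenius_sqrt_near1 n (B : 'M[R]_n) : posdef B ->
  frobenius_norm (B - 1%:M) <= frobenius_norm (B *m B - 1%:M).
Proof.
move=> [BT Bpos]; set D := B - 1%:M.
have -> : B *m B - 1%:M = D *m B + D.
  by rewrite /D mulmxBl mul1mx addrA subrK.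
rewrite -(@ler_pXn2r _ 2)// ?nnegrE ?frobenius_ge0// !sqr_frobenius.
apply: ler_sum => i _; set v := (row i D)^T.
have DBD : 0 <= \sum_j (D *m B) i j * D i j.
  have -> : \sum_j (D *m B) i j * D i j = (v^T *m B *m v) 0 0.
    rewrite trmxK [RHS]mxE; apply: eq_bigr => j _.
    by rewrite -row_mul; congr (_ * _); rewrite [RHS]mxE// [RHS]mxE.
  have [->|/Bpos/ltW//] := eqVneq v 0.
  by rewrite mulmx0 mxE.
have -> : \sum_j (D *m B + D) i j ^+ 2 = \sum_j (D *m B) i j ^+ 2 +
    2 * (\sum_j (D *m B) i j * D i j) + \sum_j D i j ^+ 2.
  rewrite mulr_sumr -!big_split; apply: eq_bigr => j _ /=.
  by rewrite mxE sqrrD mulr_natl.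
by rewrite lerDr addr_ge0 ?mulr_ge0//; apply: sumr_ge0 => j _; exact: sqr_ge0.
Qed.

End matrices_near_identity.

(** * Projected predictors and the symmetry of the scatter estimate *)

Section projection.
Context {R : realType} {p : nat}.

(** Near the identity the choice made by [inv_sqrtmx] is a genuine root, and it
    depends on the matrix in a Lipschitz way at 1. *)
Lemma inv_sqrtmx_near1 : exists2 c : R, 0 < c &
  forall S : 'M[R]_p, S^T = S -> frobenius_norm (S - 1%:M) <= c ->
  [/\ (inv_sqrtmx S)^T = inv_sqrtmx S,
      inv_sqrtmx S *m inv_sqrtmx S = invmx S &
      frobenius_norm (inv_sqrtmx S - 1%:M) <=
        2 * frobenius_norm (1%:M : 'M[R]_p) * frobenius_norm (S - 1%:M)].
Proof.
set q := frobenius_norm (1%:M : 'M[R]_p).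
have q0 : 0 <= q by exact: frobenius_ge0.
(* The radius is at most 1 / 2, for positive definiteness, and makes
   2 |1| |S - 1| at most 1 / 2p, as the square root lemma requires. *)
exists ((2 + 4 * q * p%:R)^-1).
  by rewrite invr_gt0 ltr_wpDr// !mulr_ge0.
set c := _^-1 => S ST Sc.
have c0 : 0 < c by rewrite invr_gt0 ltr_wpDr// !mulr_ge0.
have c2 : c <= 2^-1.
  by rewrite lef_pV2 ?posrE ?ltr_wpDr ?lerDl ?mulr_ge0.
have S2 := le_trans Sc c2.
have Su := posdef_unitmx (posdef_near1 ST S2).
have := frobenius_invmx_near1 Su S2; rewrite -/q => iS.
have [B [Bpos BB]] : exists B : 'M[R]_p, posdef B /\ B *m B = 1%:M + (invmx S - 1%:M).
  apply: sqrt_near1; first by rewrite linearB/= trmx1 trmx_inv ST.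
  apply: le_trans (mx_norm_le_frobenius _) _; apply: le_trans iS _.
  have [p0|p0] := posnP p.
    suff -> : q = 0 by rewrite mulr0 mul0r invr_ge0.
    apply/eqP; rewrite frobenius_eq0; apply/eqP/matrixP => i.
    by exfalso; have := ltn_ord i; rewrite [X in (_ < X)%N]p0 ltn0.
  have pR : 0 < p%:R :> R by rewrite ltr0n.
  apply: le_trans (_ : 2 * q * c <= _); first by rewrite ler_wpM2l// mulr_ge0.
  rewrite /c ler_pdivrMr ?ltr_wpDr ?mulr_ge0//.
  rewrite mulrDr -[leLHS]add0r lerD ?mulr_ge0 ?invr_ge0//.
  have -> : 4 * q * p%:R = (2 * p%:R) * (2 * q) by ring.
  by rewrite mulKf// mulf_neq0 ?gt_eqF.
rewrite addrC subrK in BB.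
have : [set B | posdef B /\ B *m B = invmx S] (inv_sqrtmx S).
  by rewrite /inv_sqrtmx; apply: (@xgetPex _ 0); exists B.
move=> [Ipos II]; split=> //; first by case: Ipos.
by apply: le_trans iS; rewrite -II; exact: frobenius_sqrt_near1.
Qed.

(** The scatter norm of v is |B v|: projecting is taking the direction of the
    standardized vector. *)
Lemma projected_predictorE (mu x : 'cV[R]_p) (S : 'M[R]_p) :
  (inv_sqrtmx S)^T = inv_sqrtmx S ->
  inv_sqrtmx S *m inv_sqrtmx S = invmx S ->
  projected_predictor mu S x = direction (inv_sqrtmx S *m (x - mu)).
Proof.
move=> BT BB; rewrite /projected_predictor /direction; congr (_^-1 *: _).
rewrite /scatter_norm -BB mulmxA -[RHS]ger0_norm ?frobenius_ge0// -sqrtr_sqr.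
by rewrite -trmx_mul_self trmx_mul BT !mulmxA.
Qed.

Lemma projected_predictor_dist (mu x : 'cV[R]_p) (S : 'M[R]_p) :
  (inv_sqrtmx S)^T = inv_sqrtmx S ->
  inv_sqrtmx S *m inv_sqrtmx S = invmx S -> x != 0 ->
  frobenius_norm (projected_predictor mu S x - direction x) <=
    2 * (frobenius_norm (inv_sqrtmx S - 1%:M) +
         frobenius_norm (inv_sqrtmx S) * frobenius_norm mu / frobenius_norm x).
Proof.
move=> BT BB x0; rewrite projected_predictorE//.
apply: le_trans (direction_lipschitz _ x0) _.
have nx : 0 < frobenius_norm x by rewrite frobenius_gt0.
rewrite ler_pM2l// ler_pdivrMr// mulrDl divfK ?gt_eqF//.
set B := inv_sqrtmx S.
have -> : B *m (x - mu) - x = (B - 1%:M) *m x - B *m mu.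
  by rewrite mulmxBr mulmxBl mul1mx addrAC.
by apply: le_trans (frobeniusD _ _) _; rewrite frobeniusN lerD// frobeniusM.
Qed.

Lemma tyler_scatter_sym n (x : nat -> 'cV[R]_p) (mu : 'cV[R]_p) (S : 'M[R]_p) :
  (tyler_scatter n x mu S)^T = tyler_scatter n x mu S.
Proof.
rewrite /tyler_scatter linearZ/=; congr (_ *: _); rewrite linearZ/=; congr (_ *: _).
rewrite raddf_sum/=.
by apply: eq_bigr => i _; rewrite linearZ/= trmx_mul trmxK.
Qed.

(** Symmetry is a closed condition; it may fail only at the initial matrix. *)
Lemma tyler_limit_sym n (x : nat -> 'cV[R]_p) update S0 mu (S : 'M[R]_p) :
  tyler_limit n x update S0 mu S -> S^T = S.
Proof.
move=> [_ S_lim]; apply: (closed_cvg _ (@closed_symmetric R p) _ _ S_lim).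
by exists 1%N => // -[|m] //= _; exact: tyler_scatter_sym.
Qed.

End projection.

(** * Unlikely events *)

Section tail_events.
Context {d : measure_display} {T : measurableType d} {R : realType}.
Variable P : probability T R.

(** With the outer measure, events defined through estimators that need not be
    measurable are covered as well. *)
Definition eventually_unlikely (E : nat -> set T) (e : R) :=
  \forall n \near \oo, ((P^* (E n))%mu <= e%:E)%E.

Lemma eventually_unlikelyU (E F : nat -> set T) (e f : R) :
  eventually_unlikely E e -> eventually_unlikely F f ->
  eventually_unlikely (fun n => E n `|` F n) (e + f).
Proof.
move=> uE uF; near=> n.
apply: (le_trans (outer_measureU2 (mu_ext P) (E n) (F n))).
by rewrite EFinD leeD//; near: n.
Unshelve. all: by end_near. Qed.

Lemma eventually_unlikely_bigU (I : Type) (s : seq I) (E : I -> nat -> set T)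
    (e : R) : (forall j, eventually_unlikely (E j) e) ->
  eventually_unlikely (fun n => \big[setU/set0]_(j <- s) E j n) (e *+ size s).
Proof.
move=> uE; elim: s => [|j s IHs] /=.
  by apply: nearW => n; rewrite big_nil mu_ext0.
by under eq_fun do rewrite big_cons; rewrite mulrS; exact: eventually_unlikelyU.
Qed.

Lemma null_unlikely (E : nat -> set T) (e : R) : 0 <= e ->
  (forall i, measurable (E i)) -> (forall i, P (E i) = 0%E) ->
  eventually_unlikely (fun n => [set w | exists2 i, (i < n)%N & E i w]) e.
Proof.
move=> e0 mE PE; apply: nearW => n.
apply: (@le_trans _ _ (P^*%mu (\bigcup_i E i))).
  by apply: le_mu_ext => w /= [i _ Ei]; exists i.
apply: le_trans (mu_ext_sigma_subadditive (measure_ge0 P) E) _.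
rewrite eseries0 ?lee_fin// => i _ _.
by rewrite measurable_mu_extE; [exact: PE|exact: mE].
Qed.

Lemma with_high_probability_unlikely (E : nat -> set T) (e : R) : 0 < e ->
  with_high_probability P E -> eventually_unlikely (fun n => ~` E n) e.
Proof.
move=> e0 /fine_cvgP[PE_fin PE]; near=> n.
rewrite -[leLHS]fineK; last by near: n.
rewrite lee_fin; apply: le_trans (ler_norm _) _; rewrite -[X in `|X|]subr0 distrC.
by near: n; move/cvgr_dist_le: PE; exact.
Unshelve. all: by end_near. Qed.

Lemma markov_inequality (f : T -> R) (t : R) : 0 < t ->
  measurable_fun setT f -> (forall w, 0 <= f w) ->
  (t%:E * P [set w | (t <= f w)%R] <= \int[P]_w (f w)%:E)%E.
Proof.
move=> t0 mf f0.
have mA : measurable [set w | t <= f w].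
  have -> : [set w | t <= f w] = f @^-1` `[t, +oo[.
    by apply/seteqP; split=> w /=; rewrite in_itv/= andbT.
  by rewrite -[X in measurable X]setTI; exact: mf.
rewrite -integral_cst//.
apply: (@le_trans _ _ (\int[P]_(w in [set w | (t <= f w)%R]) (f w)%:E)%E).
  apply: ge0_le_integral => //.
  - by move=> w _; rewrite lee_fin ltW.
  - by apply/measurable_EFinP; exact: measurable_funS mf.
apply: ge0_subset_integral => //; first exact/measurable_EFinP.
by move=> w _; rewrite lee_fin.
Qed.

End tail_events.

(** * Sums over independent copies *)

Section iid_sums.
Context {d : measure_display} {T : measurableType d} {R : realType}.
Variable P : probability T R.

Lemma bounded_integrable (f : T -> R) (M : R) :
  measurable_fun setT f -> (forall w, `|f w| <= M) ->
  P.-integrable setT (EFin \o f).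
Proof.
move=> mf fM; apply: measurable_bounded_integrable => //.
  by rewrite (le_lt_trans (probability_le1 _ _))// ltry.
exists M; split; first exact: num_real.
by move=> N MN w _ /=; rewrite (le_trans (fM w))// ltW.
Qed.

Context {d' : measure_display} {U : measurableType d'}.
Variables (Z : T -> U) (W : nat -> T -> U).
Hypotheses (mZ : measurable_fun setT Z) (mW : forall i, measurable_fun setT (W i)).
Hypothesis ZW : independent_copies P Z W.

Lemma ge0_integral_copy (g : U -> \bar R) i : measurable_fun setT g ->
  (forall u, 0 <= g u)%E -> (\int[P]_w g (W i w) = \int[P]_w g (Z w))%E.
Proof.
move=> mg g0.
rewrite -[LHS](ge0_integral_pushforward (mW i) P measurableT mg (fun u _ => g0 u)).
rewrite -[RHS](ge0_integral_pushforward mZ P measurableT mg (fun u _ => g0 u)).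
by apply: eq_measure_integral => A mA _; exact: (ZW.1 i).
Qed.

(** The joint law of two copies is the square of the common law, since they
    agree on rectangles; Fubini's theorem then factors the expectation. *)
Lemma integral_copies_prod (g : U -> R) (M : R) i j : i != j ->
  measurable_fun setT g -> (forall u, `|g u| <= M) ->
  (\int[P]_w (g (Z w))%:E = 0)%E ->
  (\int[P]_w (g (W i w) * g (W j w))%:E = 0)%E.
Proof.
move=> ij mg gM gZ0.
pose muZ := distribution P
  (HB.pack_for {mfun T >-> U} Z (isMeasurableFun.Build _ _ _ _ Z mZ)).
pose V w := (W i w, W j w).
have mV : measurable_fun setT V by exact: measurable_fun_pair.
pose muV := distribution P (HB.pack_for {mfun T >-> (U * U)%type}
  V (isMeasurableFun.Build _ _ _ _ V mV)).
pose F (z : U * U) := (g z.1 * g z.2)%:E.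
have mF : measurable_fun setT F.
  apply/measurable_EFinP; apply: measurable_funM.
    exact: measurableT_comp mg measurable_fst.
  exact: measurableT_comp mg measurable_snd.
have FM z : `|g z.1 * g z.2| <= M * M by rewrite normrM ler_pM.
have rect A B : measurable A -> measurable B ->
    muV (A `*` B) = (muZ A * muZ B)%E.
  move=> mA mB; rewrite /muV /muZ /distribution /pushforward /=.
  have [ZWm ZWi] := ZW.
  have /= := ZWi [:: i; j] (fun k => if k == i then A else B).
  rewrite /= inE (negbTE ij) => /(_ isT).
  rewrite !big_cons big_nil mule1 eqxx eq_sym (negbTE ij) !ZWm// => <-.
    congr (P _); apply/seteqP; split=> [w [/= Aw Bw] k /=|w /= ZA].
      by rewrite !inE => /orP[]/eqP ->; rewrite ?eqxx// eq_sym (negbTE ij).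
    split; first by have := ZA i; rewrite /= inE eqxx; exact.
    by have := ZA j; rewrite /= !inE eqxx orbT eq_sym (negbTE ij); exact.
  by move=> k; case: ifP.
have prodV A : measurable A -> (muZ \x muZ)%E A = muV A.
  exact: product_measure_unique.
have intF : (muZ \x muZ)%E.-integrable setT F.
  apply: measurable_bounded_integrable => //.
  - by rewrite /= prodV// (le_lt_trans (probability_le1 _ _))// ltry.
  - exact/measurable_EFinP.
  - exists (M * M); split; first exact: num_real.
    by move=> N MN z _ /=; rewrite (le_trans (FM z))// ltW.
have -> : (\int[P]_w (g (W i w) * g (W j w))%:E = \int[muV]_z F z)%E.
  rewrite /muV integral_distribution//.
  apply: (bounded_integrable (M := M * M)) => [|w]; last exact: (FM (V w)).
  by apply: measurable_funM;
    [exact: (measurableT_comp mg (mW i))|exact: (measurableT_comp mg (mW j))].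
rewrite (eq_measure_integral (muZ \x muZ)%E); last by move=> A mA _; exact/esym/prodV.
rewrite -integral12_prod_meas1//; apply: integral0_eq => a _.
rewrite /fubini_F /F /=; under eq_integral do rewrite EFinM.
have gZ : (\int[muZ]_u (g u)%:E = 0)%E.
  rewrite /muZ integral_distribution//; first exact/measurable_EFinP.
  by apply: (bounded_integrable (M := M)) => //; exact: measurableT_comp.
rewrite integralZl// ?gZ ?mule0//.
apply: measurable_bounded_integrable => //.
  by rewrite (le_lt_trans (probability_le1 _ _))// ltry.
exists M; split; first exact: num_real.
by move=> N MN u _ /=; rewrite (le_trans (gM u))// ltW.
Qed.

(** In the expectation of the squared sum the off-diagonal terms vanish, and each
    of the n diagonal terms is at most M^2. *)
Lemma chebyshev_copies (g : U -> R) (M : R) n (t : R) : 0 < t ->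
  measurable_fun setT g -> (forall u, `|g u| <= M) ->
  (\int[P]_w (g (Z w))%:E = 0)%E ->
  (P [set w | (t <= `|\sum_(i < n) g (W i w)|)%R] <= (n%:R * M ^+ 2 / t ^+ 2)%:E)%E.
Proof.
move=> t0 mg gM gZ0.
have mgW i : measurable_fun setT (fun w => g (W i w)).
  exact: (measurableT_comp mg (mW i)).
have prodM i j w : `|g (W i w) * g (W j w)| <= M * M by rewrite normrM ler_pM.
have int_prod i j : P.-integrable setT (fun w => (g (W i w) * g (W j w))%:E).
  by apply: (bounded_integrable (M := M * M)) => [|w//]; exact: measurable_funM.
pose S w := \sum_(i < n) g (W i w).
have S2 : (\int[P]_w (S w ^+ 2)%:E <= (n%:R * M ^+ 2)%:E)%E.
  under eq_integral do rewrite /S expr2 big_distrlr /= -sumEFin.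
  rewrite integral_sum//; last first.
    move=> i; under eq_fun do rewrite -sumEFin.
    by apply: integrable_sum.
  rewrite -[X in X%:R]card_ord mulr_natl -sumr_const -sumEFin.
  apply: lee_sum => i _; under eq_integral do rewrite -sumEFin.
  rewrite integral_sum// (bigD1 i)//= [X in (_ + X)%E]big1 ?adde0; last first.
    move=> j ji; apply: (integral_copies_prod (M := M)) => //.
    by rewrite eq_sym; exact: ji.
  have -> : (M * M)%:E = (\int[P]_w (M ^+ 2)%:E)%E.
    by rewrite integral_cst//= probability_setT mule1.
  apply: ge0_le_integral => //.
  - by move=> w _; rewrite lee_fin -expr2 sqr_ge0.
  - by apply/measurable_EFinP; exact: measurable_funM.
  - move=> w _; rewrite lee_fin expr2; apply: le_trans (prodM i i w).
    exact: ler_norm.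
have -> : [set w | (t <= `|\sum_(i < n) g (W i w)|)%R] =
    [set w | (t ^+ 2 <= S w ^+ 2)%R].
  have tS w : (t ^+ 2 <= S w ^+ 2) = (t <= `|S w|).
    by rewrite -(real_normK (num_real (S w))) ler_pXn2r// nnegrE ltW.
  by apply/seteqP; split=> w /=; rewrite tS.
rewrite EFinM lee_pdivlMr ?exprn_gt0// muleC; apply: le_trans S2.
apply: markov_inequality => [||w]; [exact: exprn_gt0| |exact: sqr_ge0].
by apply: measurable_funX; exact: measurable_sum.
Qed.

Lemma bounded_sum_rate (g : U -> R) (M e : R) : 0 < e ->
  measurable_fun setT g -> (forall u, `|g u| <= M) ->
  (\int[P]_w (g (Z w))%:E = 0)%E ->
  exists K : R, eventually_unlikely P
    (fun n => [set w | K * Num.sqrt n%:R < `|\sum_(i < n) g (W i w)|]) e.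
Proof.
move=> e0 mg gM gZ0.
(* As K >= 1, M^2 / K^2 <= M^2 / K <= e. *)
pose K := 1 + M ^+ 2 / e.
have K1 : 1 <= K by rewrite lerDl divr_ge0 ?sqr_ge0 ?ltW.
exists K; near=> n.
have n0 : 0 < n%:R :> R by rewrite ltr0n; near: n; exact: nbhs_infty_gt.
have t0 : 0 < K * Num.sqrt n%:R by rewrite mulr_gt0 ?sqrtr_gt0// (lt_le_trans _ K1).
have mA : measurable [set w | (K * Num.sqrt n%:R <= `|\sum_(i < n) g (W i w)|)%R].
  have -> : [set w | (K * Num.sqrt n%:R <= `|\sum_(i < n) g (W i w)|)%R] =
      (fun w => `|\sum_(i < n) g (W i w)|) @^-1` `[K * Num.sqrt n%:R, +oo[.
    by apply/seteqP; split=> w /=; rewrite in_itv/= andbT.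
  rewrite -[X in measurable X]setTI.
  have mS : measurable_fun setT (fun w => `|\sum_(i < n) g (W i w)|).
    apply: measurableT_comp => //; apply: measurable_sum => i.
    exact: (measurableT_comp mg (mW i)).
  exact: mS.
apply: (@le_trans _ _ (P [set w | (K * Num.sqrt n%:R <= `|\sum_(i < n) g (W i w)|)%R])).
  rewrite -(measurable_mu_extE P mA).
  by apply: le_mu_ext => w /= /ltW.
apply: le_trans (chebyshev_copies _ t0 mg gM gZ0) _.
rewrite lee_fin ler_pdivrMr ?exprn_gt0// exprMn sqr_sqrtr ?ler0n//.
rewrite (_ : e * _ = n%:R * (e * K ^+ 2)); last by ring.
rewrite ler_pM2l//.
have : M ^+ 2 = (K - 1) * e by rewrite /K addrC addrA addNr add0r divfK ?gt_eqF.
nra.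
Unshelve. all: by end_near. Qed.

Lemma nonneg_sum_rate (g : U -> R) (c e : R) : 0 < e ->
  measurable_fun setT g -> (forall u, 0 <= g u) ->
  (\int[P]_w (g (Z w))%:E <= c%:E)%E ->
  exists K : R, eventually_unlikely P
    (fun n => [set w | K * n%:R < \sum_(i < n) g (W i w)]) e.
Proof.
move=> e0 mg g0 gZc; exists ((`|c| + 1) / e); near=> n.
have n0 : 0 < n%:R :> R by rewrite ltr0n; near: n; exact: nbhs_infty_gt.
set K := (_ + _) / e.
have K0 : 0 < K by rewrite divr_gt0// ltr_wpDl.
have mgW i : measurable_fun setT (fun w => g (W i w)).
  exact: (measurableT_comp mg (mW i)).
have mS : measurable_fun setT (fun w => \sum_(i < n) g (W i w)).
  exact: measurable_sum.
have mA : measurable [set w | (K * n%:R <= \sum_(i < n) g (W i w))%R].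
  have -> : [set w | (K * n%:R <= \sum_(i < n) g (W i w))%R] =
      (fun w => \sum_(i < n) g (W i w)) @^-1` `[K * n%:R, +oo[.
    by apply/seteqP; split=> w /=; rewrite in_itv/= andbT.
  by rewrite -[X in measurable X]setTI; exact: mS.
apply: (@le_trans _ _ (P [set w | (K * n%:R <= \sum_(i < n) g (W i w))%R])).
  by rewrite -(measurable_mu_extE P mA); apply: le_mu_ext => w /= /ltW.
have t0 : 0 < K * n%:R by rewrite mulr_gt0.
rewrite -(lee_pmul2l (x := (K * n%:R)%:E))//.
apply: le_trans (markov_inequality P t0 mS _) _ => [w|]; first exact: sumr_ge0.
under eq_integral do rewrite -sumEFin.
rewrite ge0_integral_sum//; last 2 first.
- by move=> i; exact/measurable_EFinP.
- by move=> i w _; rewrite lee_fin.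
apply: (@le_trans _ _ (\sum_(i < n) c%:E)%E).
  apply: lee_sum => i _.
  rewrite (ge0_integral_copy (g := EFin \o g)); first exact: gZc.
    exact/measurable_EFinP.
  by move=> u; rewrite lee_fin.
rewrite -EFinM (@sumEFin _ _ _ xpredT (fun=> c)) lee_fin sumr_const card_ord.
rewrite -[leLHS]mulr_natl.
have -> : K * n%:R * e = n%:R * (`|c| + 1) by rewrite /K; field; rewrite gt_eqF.
by rewrite ler_pM2l// ler_wpDr// ler_norm.
Unshelve. all: by end_near. Qed.

End iid_sums.

(** * Finiteness of the inverse moment *)

Section inverse_moment.
Context {d : measure_display} {T : measurableType d} {R : realType}.
Variable P : probability T R.

Lemma dyadic_bracket (x : R) : 1 <= x -> exists k, 2 ^+ k <= x <= 2 ^+ k.+1.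
Proof.
move=> x1.
have ex_n : exists n, x <= 2 ^+ n.
  exists (Num.bound x); apply: le_trans (_ : (Num.bound x)%:R <= _).
    by apply/ltW/archi_boundP; exact: le_trans x1.
  by rewrite -natrX ler_nat ltnW// ltn_expl.
case: (ex_minnP ex_n) => -[|k] xk min_k.
  by exists 0%N; rewrite expr0 x1 (le_trans xk)// expr0 expr1 ler1n.
exists k; rewrite xk andbT leNgt; apply/negP => /ltW /min_k.
by rewrite ltnn.
Qed.

(** If 2^k <= x <= 2^(k+1) then x is at most the k-th term of the series of the
    2^(j+1) 1{2^j <= x}, so X is at most 1 plus that series; its j-th term has
    expectation at most 2 D / 2^j. *)
Lemma expectation_le_tail (X : T -> R) (D : R) : 0 <= D ->
  measurable_fun setT X -> (forall w, 0 <= X w) ->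
  (forall t : R, 0 < t -> (P [set w | (t <= X w)%R] <= (D / t ^+ 2)%:E)%E) ->
  (\int[P]_w (X w)%:E <= (1 + 4 * D)%:E)%E.
Proof.
move=> D0 mX X0 tailX.
pose A k := [set w | (2 ^+ k <= X w)%R].
have mA k : measurable (A k).
  have -> : A k = X @^-1` `[2 ^+ k, +oo[.
    by apply/seteqP; split=> w /=; rewrite /A/= in_itv/= andbT.
  by rewrite -[X in measurable X]setTI; exact: mX.
pose f k w : \bar R := (2 ^+ k.+1 * \1_(A k) w)%:E.
have f0 k w : (0 <= f k w)%E by rewrite lee_fin mulr_ge0.
have mf k : measurable_fun setT (f k).
  by apply/measurable_EFinP; apply: measurable_funM => //; exact: measurable_indic.
have Xf w : ((X w)%:E <= 1 + \sum_(0 <= k <oo) f k w)%E.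
  have [X1|X1] := leP (X w) 1.
    rewrite (@le_trans _ _ 1%E) ?lee_fin// leeDl//.
    by apply: nneseries_ge0 => k _ _; exact: f0.
  have [k /andP[kX Xk]] := dyadic_bracket (ltW X1).
  apply: (@le_trans _ _ (f k w)).
    by rewrite /f lee_fin indicE mem_set ?mulr1.
  apply: (@le_trans _ _ (\sum_(0 <= i < k.+1) f i w)%E).
    by rewrite big_nat_recr//= leeDr// sume_ge0.
  apply: (@le_trans _ _ (\sum_(0 <= i <oo) f i w)%E).
    by apply: nneseries_lim_ge => i _ _; exact: f0.
  by rewrite leeDr.
apply: (@le_trans _ _ (\int[P]_w (1 + \sum_(0 <= k <oo) f k w))%E).
  apply: ge0_le_integral => //.
  - by move=> w _; rewrite lee_fin.
  - exact/measurable_EFinP.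
  - apply: emeasurable_funD => //.
    by apply: ge0_emeasurable_sum.
rewrite ge0_integralD//; last 2 first.
- by move=> w _; apply: nneseries_ge0 => k _ _; exact: f0.
- exact: ge0_emeasurable_sum.
rewrite (_ : \int[P]_w 1 = 1)%E; last by rewrite integral_cst// mul1e [LHS]probability_setT.
rewrite EFinD leeD2l//.
rewrite integral_nneseries//.
apply: lime_le.
  by apply: is_cvg_nneseries => k _ _; apply: integral_ge0.
apply: nearW => n.
have half_sum : \sum_(0 <= k < n) 2 * D * 2^-1 ^+ k = 4 * D * (1 - 2^-1 ^+ n).
  elim: n => [|n IHn]; first by rewrite big_nil expr0 subrr mulr0.
  by rewrite big_nat_recr//= IHn exprS; field.
apply: le_trans (_ : (\sum_(0 <= k < n) 2 * D * 2^-1 ^+ k)%:E <= _)%E; last first.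
  by rewrite lee_fin half_sum ler_piMr ?mulr_ge0// gerBl exprn_ge0.
rewrite -sumEFin; apply: lee_sum => k _.
rewrite /f; under eq_integral do rewrite EFinM.
rewrite ge0_integralZl//; last by apply/measurable_EFinP; exact: measurable_indic.
rewrite integral_indic// setIT.
apply: (@le_trans _ _ ((2 ^+ k.+1)%:E * (D / (2 ^+ k) ^+ 2)%:E)%E).
  by rewrite lee_pmul2l ?lte_fin//; apply: tailX.
rewrite lee_fin le_eqVlt; apply/orP; left; apply/eqP.
by rewrite exprS exprVn; field; rewrite expf_neq0.
Qed.

(** For 0 < t < 1 the factor t^(- alpha) is at least 1. *)
Lemma density_bounded_near0 (h : R -> R) (alpha C : R) :
  0 <= alpha -> 0 <= C -> (forall t, 0 <= h t) ->
  t `^ (- alpha) * h t @[t --> 0^'+] --> C ->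
  exists2 c : R, 0 < c & forall t, 0 < t < c -> h t <= C + 1.
Proof.
move=> alpha0 C0 h0 hC.
have : \forall t \near 0^'+, t `^ (- alpha) * h t < C + 1.
  by move/cvgr_lt: hC; apply; rewrite ltrDl.
rewrite near_withinE => /nbhs_ballP[/= e e0 he].
exists (Num.min e 1) => [|t]; first by rewrite lt_min ltr01 andbT.
rewrite lt_min => /and3P[t0 te t1]; apply: le_trans (ltW (he t _ t0)); last first.
  by rewrite /ball/= sub0r normrN gtr0_norm.
rewrite ler_peMl// powRN invf_ge1 ?powR_gt0//.
by rewrite -(powRr0 t) ger_powR// t0 ltW.
Qed.

Section density.
Variables (q : T -> R) (h : R -> R).
Hypotheses (mq : measurable_fun setT q) (q0 : forall w, 0 <= q w).
Hypothesis q_density : has_density P (@lebesgue_measure R) q h.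

Lemma density_null_point (a : R) : P [set w | q w = a] = 0%E.
Proof.
have [_ _ qh] := q_density.
have -> : [set w | q w = a] = q @^-1` [set a] by [].
by rewrite qh// integral_set1.
Qed.

(** The event t <= 1 / sqrt q is 0 < q <= t^-2.  Where h is bounded by H its
    probability is at most H t^-2; for the remaining t, those with c <= t^-2,
    already 1 <= c^-1 t^-2. *)
Lemma inverse_sqrt_integrable (c H : R) : 0 < c -> 0 <= H ->
  (forall t, 0 < t < c -> h t <= H) ->
  exists C : R, (\int[P]_w ((Num.sqrt (q w))^-1)%:E <= C%:E)%E.
Proof.
move=> c0 H0 hH; have [mh h0 qh] := q_density.
have mV : measurable_fun setT (fun w => (Num.sqrt (q w))^-1).
  (* The inverse square root is read as a real power, measurable on the line. *)
  under eq_fun do rewrite -powR12_sqrt// -powRN.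
  exact: (measurableT_comp (measurable_powR _) mq).
pose D := H + c^-1; exists (1 + 4 * D).
apply: expectation_le_tail.
- by rewrite addr_ge0// invr_ge0 ltW.
- exact: mV.
- by move=> w; rewrite invr_ge0 sqrtr_ge0.
move=> t t0.
have t20 : 0 < t ^+ 2 by rewrite exprn_gt0.
have [ct|tc] := leP c (t ^- 2).
  apply: le_trans (probability_le1 _ _) _.
    have -> : [set w | (t <= (Num.sqrt (q w))^-1)%R] =
        (fun w => (Num.sqrt (q w))^-1) @^-1` `[t, +oo[.
      by apply/seteqP; split=> w /=; rewrite in_itv/= andbT.
    by rewrite -[X in measurable X]setTI; exact: mV.
  rewrite lee_fin ler_pdivlMr// mul1r.
  apply: (@le_trans _ _ c^-1); last by rewrite lerDr.
  by rewrite -[leLHS]invrK lef_pV2 ?posrE ?invr_gt0//.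
have -> : [set w | (t <= (Num.sqrt (q w))^-1)%R] = q @^-1` `]0, t ^- 2].
  apply/seteqP; split=> w /=; rewrite in_itv/=.
    (* The convention 0^-1 = 0 keeps q w = 0 out of the event. *)
    have [->|qw] := eqVneq (q w) 0; first by rewrite sqrtr0 invr0 leNgt t0.
    have qp : 0 < q w by rewrite lt_def qw q0.
    rewrite qp => tq /=.
    have {}tq : Num.sqrt (q w) <= t^-1.
      by rewrite -[leLHS]invrK lef_pV2 ?posrE ?invr_gt0 ?sqrtr_gt0//.
    by rewrite -exprVn -[leLHS]sqr_sqrtr// ler_pXn2r ?nnegrE ?invr_ge0 ?sqrtr_ge0 ?(ltW t0).
  move=> /andP[qp qt]; rewrite -[leLHS]invrK lef_pV2 ?posrE ?invr_gt0 ?sqrtr_gt0//.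
  by rewrite -(@ler_pXn2r _ 2) ?nnegrE ?invr_ge0 ?(ltW t0)// sqr_sqrtr// exprVn.
rewrite qh//.
apply: (@le_trans _ _ (\int[lebesgue_measure]_(u in `]0%R, (t ^- 2)%R]) H%:E)%E).
  apply: ge0_le_integral => //.
  - by move=> u _; rewrite lee_fin.
  - by apply/measurable_EFinP; exact: measurable_funS mh.
  - move=> u /=; rewrite in_itv/= lee_fin => /andP[u0 ut].
    by rewrite hH// u0 (le_lt_trans ut).
rewrite integral_cst//= lebesgue_measure_itv/= lte_fin invr_gt0 t20.
rewrite -EFinB subr0 -EFinM lee_fin ler_pM2r ?invr_gt0//.
by rewrite lerDl invr_ge0 ltW.
Qed.

End density.
End inverse_moment.

(** * The slice mean *)

Section deterministic.
Context {R : realType}.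

Lemma near_sqrt_ge (A : R) : \forall n \near \oo, A <= Num.sqrt n%:R.
Proof.
exists (Num.bound (A ^+ 2)) => // n /= An.
apply: le_trans (ler_norm A) _; rewrite -sqrtr_sqr ler_sqrt ?ler0n//.
apply: le_trans (_ : (Num.bound (A ^+ 2))%:R <= _); last by rewrite ler_nat.
exact/ltW/archi_boundP/sqr_ge0.
Qed.

Lemma frobenius_col_le_sum p (v : 'cV[R]_p) :
  frobenius_norm v <= \sum_j `|v j 0|.
Proof.
have -> : v = \sum_j v j 0 *: delta_mx j 0.
  apply/matrixP => i j; rewrite ord1 summxE (bigD1 i)//= !mxE !eqxx mulr1.
  rewrite big1 ?addr0// => l li.
  by rewrite !mxE eq_sym (negbTE li) mulr0.
apply: le_trans (frobenius_sum _ _) _; apply: ler_sum => j _.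
rewrite frobeniusZ summxE (bigD1 j)//= !mxE !eqxx mulr1 big1 ?addr0; last first.
  by move=> l li; rewrite !mxE eq_sym (negbTE li) mulr0.
rewrite ler_piMr// /frobenius_norm (bigD1 j)//= big_ord1 mxE !eqxx big1.
  by rewrite addr0 expr1n sqrtr1.
by move=> i ij; rewrite big_ord1 mxE (negbTE ij) expr0n.
Qed.

(** The decomposition of the slice mean into the error of the projections and the
    fluctuation of the true directions. *)
Lemma slice_mean_dist p n (y : nat -> nat) (x : nat -> 'cV[R]_p)
    (mu : 'cV[R]_p) (S : 'M[R]_p) k (m : 'cV[R]_p) (s : R) :
  (inv_sqrtmx S)^T = inv_sqrtmx S ->
  inv_sqrtmx S *m inv_sqrtmx S = invmx S ->
  (forall i, (i < n)%N -> x i != 0) ->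
  \sum_(i < n) (frobenius_norm (x i))^-1 <= s ->
  0 < \sum_(i < n) (y i == k)%:R :> R ->
  (\sum_(i < n) (y i == k)%:R) * frobenius_norm (slice_mean n y x mu S k - m) <=
    2 * (n%:R * frobenius_norm (inv_sqrtmx S - 1%:M) +
         frobenius_norm (inv_sqrtmx S) * frobenius_norm mu * s) +
    \sum_j `|\sum_(i < n) (y i == k)%:R * (direction (x i) j 0 - m j 0)|.
Proof.
move=> BT BB x0 xs nk0; set nk := \sum_(i < n) _.
rewrite -[X in X * _](gtr0_norm nk0) -frobeniusZ.
have -> : nk *: (slice_mean n y x mu S k - m) =
    \sum_(i < n) (y i == k)%:R *: (projected_predictor mu S (x i) - direction (x i)) +
    \sum_(i < n) (y i == k)%:R *: (direction (x i) - m).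
  rewrite scalerBr scalerA divff ?gt_eqF// scale1r -big_split/= scaler_suml -sumrB.
  by apply: eq_bigr => i _; rewrite -scalerDr -scalerBr addrA subrK.
apply: le_trans (frobeniusD _ _) _; apply: lerD; last first.
  apply: le_trans (frobenius_col_le_sum _) _; apply: ler_sum => j _.
  rewrite summxE le_eqVlt; apply/orP; left; apply/eqP; congr `|_|.
  by apply: eq_bigr => i _; rewrite !mxE.
apply: le_trans (frobenius_sum _ _) _.
apply: le_trans (_ : \sum_(i < n) 2 * (frobenius_norm (inv_sqrtmx S - 1%:M) +
    frobenius_norm (inv_sqrtmx S) * frobenius_norm mu / frobenius_norm (x i)) <= _).
  apply: ler_sum => i _; rewrite frobeniusZ.
  apply: le_trans _ (projected_predictor_dist mu BT BB (x0 _ (ltn_ord i))).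
  by rewrite ler_piMl ?frobenius_ge0//; case: eqP; rewrite ?normr1 ?normr0.
rewrite -mulr_sumr ler_pM2l// big_split/= sumr_const card_ord mulr_natl lerD2l.
by rewrite -mulr_sumr ler_wpM2l// mulr_ge0// frobenius_ge0.
Qed.

(** All the randomness enters through the hypotheses: when the sums and the
    estimators stay within their typical size, with r = sqrt n, the slice mean
    is at distance O(1 / r) from m. *)
Lemma slice_mean_rate p n (y : nat -> nat) (x : nat -> 'cV[R]_p)
    (mu : 'cV[R]_p) (S : 'M[R]_p) k (m : 'cV[R]_p)
    (r pk Kn a b c Ki : R) (Kd : 'I_p -> R) :
  0 < r -> r ^+ 2 = n%:R -> 0 < pk -> 2 / pk * Kn <= r ->
  `|\sum_(i < n) ((y i == k)%:R - pk)| <= Kn * r ->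
  (forall j, `|\sum_(i < n) (y i == k)%:R * (direction (x i) j 0 - m j 0)|
     <= Kd j * r) ->
  (forall i, (i < n)%N -> x i != 0) ->
  \sum_(i < n) (frobenius_norm (x i))^-1 <= Ki * n%:R ->
  (inv_sqrtmx S)^T = inv_sqrtmx S ->
  inv_sqrtmx S *m inv_sqrtmx S = invmx S ->
  r * frobenius_norm (inv_sqrtmx S - 1%:M) <= a ->
  frobenius_norm (inv_sqrtmx S) <= b ->
  r * frobenius_norm mu <= c ->
  frobenius_norm (slice_mean n y x mu S k - m) <=
    2 / pk * (2 * (a + b * c * Ki) + \sum_j Kd j) / r.
Proof.
move=> r0 r2 pk0 rK nk_near coords x0 inv_le BT BB a_ge b_ge c_ge.
pose nk : R := \sum_(i < n) (y i == k)%:R.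
have nk_ge : r ^+ 2 * pk / 2 <= nk.
  move: nk_near; rewrite sumrB sumr_const card_ord -/nk -[pk *+ n]mulr_natl -r2.
  rewrite ler_norml => /andP[nk_near _]; rewrite -(ler_pM2l pk0) in rK.
  have {}rK : 2 * Kn <= pk * r by rewrite mulrA mulrCA divff ?gt_eqF// mulr1 in rK.
  by nra.
have nk0 : 0 < nk.
  by apply: lt_le_trans nk_ge; rewrite divr_gt0// mulr_gt0// exprn_gt0.
have n0 : 0 < n%:R :> R by rewrite -r2 exprn_gt0.
have Ki0 : 0 <= Ki.
  rewrite -(pmulr_lge0 _ n0); apply: le_trans inv_le.
  by apply: sumr_ge0 => i _; rewrite invr_ge0 frobenius_ge0.
have coords_sum : \sum_j `|\sum_(i < n) (y i == k)%:R *
    (direction (x i) j 0 - m j 0)| <= (\sum_j Kd j) * r.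
  by rewrite mulr_suml; exact: ler_sum.
have := slice_mean_dist mu m BT BB x0 inv_le nk0.
set D := frobenius_norm (slice_mean _ _ _ _ _ _ - _).
rewrite -/nk -r2 => nkD.
set beta := frobenius_norm (inv_sqrtmx S - 1%:M) in a_ge nkD.
set nB := frobenius_norm (inv_sqrtmx S) in b_ge nkD.
set nmu := frobenius_norm mu in c_ge nkD.
set G := _ + \sum_j Kd j.
have rG : r ^+ 2 * pk / 2 * D <= r * G.
  apply: le_trans (_ : nk * D <= _); first by rewrite ler_wpM2r// frobenius_ge0.
  apply: le_trans nkD _; rewrite /G [leRHS]mulrDr (mulrC r (\sum_j Kd j)).
  apply: lerD => //; rewrite [leRHS]mulrCA ler_pM2l// [leRHS]mulrDr.
  apply: lerD; first by rewrite expr2 -[leLHS]mulrA ler_pM2l.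
  have -> : nB * nmu * (Ki * r ^+ 2) = r * (nB * (r * nmu) * Ki) by ring.
  rewrite ler_pM2l// ler_wpM2r//; apply: ler_pM => //; first exact: frobenius_ge0.
  by rewrite mulr_ge0 ?(ltW r0)// frobenius_ge0.
rewrite ler_pdivlMr//.
rewrite -(@ler_pM2l _ (r * (pk / 2))) ?mulr_gt0 ?divr_gt0//.
apply: le_trans (_ : r * G <= _).
  by apply: le_trans rG; rewrite le_eqVlt; apply/orP; left; apply/eqP; field.
by rewrite le_eqVlt; apply/orP; left; apply/eqP; field; rewrite gt_eqF.
Qed.

End deterministic.

Section measurability.
Context {R : realType} {p : nat}.

Lemma sqr_frobenius_tuple_col (t : p.-tuple R) :
  frobenius_norm (tuple_col t) ^+ 2 = \sum_(j < p) tnth t j ^+ 2.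
Proof.
by rewrite sqr_frobenius; apply: eq_bigr => j _; rewrite big_ord1 mxE.
Qed.

Lemma measurable_frobenius_tuple_col :
  measurable_fun setT (fun t : p.-tuple R => frobenius_norm (tuple_col t)).
Proof.
have -> : (fun t : p.-tuple R => frobenius_norm (tuple_col t)) =
    @Num.sqrt R \o (fun t : p.-tuple R => \sum_(j < p) tnth t j ^+ 2).
  apply/funext => t /=; rewrite -sqr_frobenius_tuple_col sqrtr_sqr.
  by rewrite ger0_norm// frobenius_ge0.
apply: measurableT_comp.
  by apply: continuous_measurable_fun; exact: sqrt_continuous.
by apply: measurable_sum => j; apply: measurable_funX; exact: measurable_tnth.
Qed.

Lemma measurable_frobenius_inv :
  measurable_fun setT (fun t : p.-tuple R => (frobenius_norm (tuple_col t))^-1).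
Proof.
(* Inversion is read as a real power, which is measurable on the whole line. *)
under eq_fun do rewrite -powR_inv1 ?frobenius_ge0//.
apply: (measurableT_comp (measurable_powR _)).
exact: measurable_frobenius_tuple_col.
Qed.

Lemma measurable_direction_tuple_col j :
  measurable_fun setT (fun t : p.-tuple R => direction (tuple_col t) j 0).
Proof.
under eq_fun do rewrite mxE mxE.
by apply: measurable_funM; [exact: measurable_frobenius_inv|exact: measurable_tnth].
Qed.

End measurability.

Section conditional_mean.
Context {d : measure_display} {T : measurableType d} {R : realType}.
Variable P : probability T R.

Lemma conditional_mean_centred (f : T -> R) (M : R) (E : set T) :
  measurable E -> (0 < P E)%E -> measurable_fun setT f ->
  (forall w, `|f w| <= M) ->
  (\int[P]_w (\1_E w * (f w - (\int[P]_(u in E) f u)%R / fine (P E)))%:E = 0)%E.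
Proof.
move=> mE PE0 mf fM; set c := _ / _.
have PEfin : P E \is a fin_num by exact: fin_num_measure.
have intf : P.-integrable E (EFin \o f).
  by apply: integrableS (bounded_integrable P mf fM).
transitivity (\int[P]_(w in E) (f w - c)%:E)%E.
  rewrite [RHS]integral_mkcond; apply: eq_integral => w _.
  by rewrite patchE indicE; case: ifP => _; rewrite ?mul1r ?mul0r.
under eq_integral do rewrite EFinB.
rewrite integralB//; last by apply: measurable_bounded_integrable => //;
  [rewrite ltey_eq PEfin|exact: bounded_cst].
rewrite integral_cst// -[X in (_ * X)%E]fineK// -EFinM /c divfK ?fineK//.
- by rewrite subee//; exact: integrable_fin_num.
- exact: integrable_fin_num.
- by rewrite gt_eqF// -lte_fin fineK.
Qed.

End conditional_mean.

Theorem theorem11 (R : realType) (d : measure_display) (T : measurableType d)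
    (P : probability T R) (p K : nat) (hp : (1 < p)%N) (hK : (1 < K)%N)
    (X : {RV P >-> p.-tuple R}) (Y : {RV P >-> nat})
    (x : nat -> {RV P >-> p.-tuple R}) (y : nat -> {RV P >-> nat})
    (f : R -> R)
    (X_elliptical : has_density P (@lebesgue_tuple R p) X
       (fun t => f (frobenius_norm (tuple_col t) ^+ 2)))
    (Y_support : [set k | (0 < P (Y @^-1` [set k]))%E] =
                 [set k | (1 <= k <= K)%N])
    (sample : independent_copies P (fun w => (Y w, X w))
       (fun i w => (y i w, x i w)))
    (update : bool) (S0 : nat -> T -> 'M[R]_p)
    (S0_posdef : forall n w, posdef (S0 n w))
    (muhat : nat -> T -> 'cV[R]_p) (Sigmahat : nat -> T -> 'M[R]_p)
    (tyler_estimators : with_high_probability P (fun n =>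
       [set w | tyler_limit n (fun i => tuple_col (x i w)) update (S0 n w)
                  (muhat n w) (Sigmahat n w)]))
    (muhat_rate : bigO_prob P muhat (fun n => (Num.sqrt n%:R)^-1))
    (Sigmahat_rate : bigO_prob P (fun n w => Sigmahat n w - 1%:M)
       (fun n => (Num.sqrt n%:R)^-1))
    (h : R -> R) (alpha Calpha : R)
    (normX_density : has_density P (@lebesgue_measure R)
       (fun w => frobenius_norm (tuple_col (X w)) ^+ 2) h)
    (halpha : 1 < alpha) (hCalpha : 0 < Calpha)
    (h_at_0 : t `^ (- alpha) * h t @[t --> 0^'+] --> Calpha)
    (k : nat) (hk : (1 <= k <= K)%N) :
  bigO_prob P
    (fun n w =>
       slice_mean n (fun i => y i w) (fun i => tuple_col (x i w))
         (muhat n w) (Sigmahat n w) k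
       - conditional_mean P (fun w => direction (tuple_col (X w)))
           (Y @^-1` [set k]))
    (fun n => (Num.sqrt n%:R)^-1).
Proof.
move=> e e0.
pose Z w := (Y w, X w); pose W i w := (y i w, x i w).
have mZ : measurable_fun setT Z by apply: measurable_fun_pair; exact: measurable_funPT.
have mW i : measurable_fun setT (W i).
  by apply: measurable_fun_pair; exact: measurable_funPT.
pose E := Y @^-1` [set k]; pose pk := fine (P E).
have mE : measurable E by exact: measurable_funPTI.
have PE0 : (0 < P E)%E.
  have : [set k | (1 <= k <= K)%N] k by [].
  by rewrite -Y_support.
have pk0 : 0 < pk by rewrite -lte_fin fineK// fin_num_measure.
pose u w := direction (tuple_col (X w)).
pose m := conditional_mean P u E.
(* Seven exceptional events share the allowance e. *)
pose e1 := e / 7; have e10 : 0 < e1 by rewrite divr_gt0.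
have z_indic w : (Y w == k)%:R = \1_E w :> R.
  rewrite indicE; congr ((nat_of_bool _)%:R); apply/eqP/idP => [Yk|]; first by rewrite inE.
  by rewrite inE.
have m_slice : measurable_fun setT (fun v : nat * p.-tuple R => (v.1 == k)%:R : R).
  have -> : (fun v : nat * p.-tuple R => (v.1 == k)%:R : R) =
      \1_(fst @^-1` [set k]).
    apply/funext => v; rewrite indicE; congr ((nat_of_bool _)%:R).
    by apply/eqP/idP => [vk|]; rewrite inE.
  apply: measurable_indic; rewrite -[X in measurable X]setTI.
  exact: measurable_fst.
have [Kn slice_size] : exists Kn, eventually_unlikely P (fun n =>
    [set w | Kn * Num.sqrt n%:R < `|\sum_(i < n) ((y i w == k)%:R - pk)|]) e1.
  apply: (@bounded_sum_rate _ _ _ _ _ _ _ _ mZ mW sample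
    (fun v => (v.1 == k)%:R - pk) (1 + `|pk|)) => //.
  - exact: measurable_funB.
  - move=> v; apply: le_trans (ler_normB _ _) _; rewrite lerD2r.
    by case: (_ == k); rewrite ?normr1 ?normr0.
  rewrite /Z /=; under eq_integral do rewrite z_indic EFinB.
  rewrite integralB//=; last 2 first.
  - apply: (@bounded_integrable _ _ _ P _ 1) => [|w]; first exact: measurable_indic.
    by rewrite indicE; case: (_ \in _); rewrite ?normr1 ?normr0.
  - by apply: (@bounded_integrable _ _ _ P _ `|pk|).
  rewrite integral_indic// setIT integral_cst// [X in (_ * X)%E]probability_setT.
  by rewrite mule1 /pk fineK ?subee// fin_num_measure.
have [Kd coords] : exists Kd : 'I_p -> R, eventually_unlikely P (fun n =>
    \big[setU/set0]_(j <- enum 'I_p) [set w | Kd j * Num.sqrt n%:R <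
       `|\sum_(i < n) (y i w == k)%:R * (direction (tuple_col (x i w)) j 0 - m j 0)|]) e1.
  have coord j : exists Kj : R, eventually_unlikely P (fun n =>
      [set w | Kj * Num.sqrt n%:R < `|\sum_(i < n)
         (y i w == k)%:R * (direction (tuple_col (x i w)) j 0 - m j 0)|])
      (e1 / p%:R).
    have dir1 (v : 'cV[R]_p) : `|direction v j 0| <= 1.
      exact: le_trans (entry_le_frobenius _ _ _) (frobenius_direction_le1 _).
    apply: (@bounded_sum_rate _ _ _ _ _ _ _ _ mZ mW sample
      (fun v => (v.1 == k)%:R * (direction (tuple_col v.2) j 0 - m j 0))
      (1 + `|m j 0|)).
    - by rewrite divr_gt0// ltr0n ltnW.
    - apply: measurable_funM => //; apply: measurable_funB => //.
      exact: (measurableT_comp (measurable_direction_tuple_col j) measurable_snd).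
    - move=> v; rewrite normrM -[leRHS]mul1r ler_pM//.
        by case: (_ == k); rewrite ?normr1 ?normr0.
      by apply: le_trans (ler_normB _ _) _; rewrite lerD2r.
    rewrite /Z /m /conditional_mean mxE /u.
    under eq_integral do rewrite z_indic.
    apply: (@conditional_mean_centred _ _ _ P _ 1) => //.
    exact: (measurableT_comp (measurable_direction_tuple_col j)).
  have [Kd Kd_coord] := choice coord; exists Kd.
  have p0 : p%:R != 0 :> R by rewrite pnatr_eq0 -lt0n ltnW.
  have -> : e1 = e1 / p%:R *+ size (enum 'I_p).
    by rewrite -cardE card_ord -mulr_natr divfK.
  exact: eventually_unlikely_bigU.
have mq : measurable_fun setT (fun w => frobenius_norm (tuple_col (X w)) ^+ 2).
  apply: measurable_funX.
  exact: (measurableT_comp measurable_frobenius_tuple_col).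
have [Ki inverse] : exists Ki : R, eventually_unlikely P (fun n =>
    [set w | Ki * n%:R < \sum_(i < n) (frobenius_norm (tuple_col (x i w)))^-1]) e1.
  have [_ h0 _] := normX_density.
  have [t0 t00 ht] := density_bounded_near0 (ltW (lt_trans ltr01 halpha))
    (ltW hCalpha) h0 h_at_0.
  have [C hC] := inverse_sqrt_integrable mq (fun w => sqr_ge0 _) normX_density
    t00 (addr_ge0 (ltW hCalpha) ler01) ht.
  apply: (@nonneg_sum_rate _ _ _ _ _ _ _ _ mZ mW sample
    (fun v => (frobenius_norm (tuple_col v.2))^-1) C) => //.
  - exact: (measurableT_comp measurable_frobenius_inv measurable_snd).
  - by move=> v; rewrite invr_ge0 frobenius_ge0.
  apply: le_trans hC; rewrite le_eqVlt; apply/orP; left; apply/eqP.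
  by apply: eq_integral => w _; rewrite sqrtr_sqr ger0_norm// frobenius_ge0.
have null : eventually_unlikely P (fun n =>
    [set w | exists2 i, (i < n)%N & [set w | tuple_col (x i w) = 0] w]) e1.
  have m0 : measurable [set v : nat * p.-tuple R | tuple_col v.2 = 0].
    have -> : [set v : nat * p.-tuple R | tuple_col v.2 = 0] =
        (fun v => frobenius_norm (tuple_col v.2)) @^-1` [set 0].
      by apply/seteqP; split=> v /=; [move=> ->; exact: frobenius0|
        move/eqP; rewrite frobenius_eq0 => /eqP].
    rewrite -[X in measurable X]setTI.
    exact: (measurableT_comp measurable_frobenius_tuple_col measurable_snd).
  apply: (@null_unlikely _ _ _ P (fun i => [set w | tuple_col (x i w) = 0])).
  - exact: ltW.
  - by move=> i; rewrite -[X in measurable X]setTI; exact: (mW i measurableT _ m0).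
  - move=> i; rewrite -(density_null_point normX_density 0).
    rewrite -[LHS]/(P (W i @^-1` [set v | tuple_col v.2 = 0])) (sample.1 i _ m0).
    congr (P _); apply/seteqP; split=> w /=; first by move=> ->; rewrite frobenius0 expr0n.
    by move/eqP; rewrite sqrf_eq0 frobenius_eq0 => /eqP.
have tyler := with_high_probability_unlikely e10 tyler_estimators.
have [Mmu mu_small] := muhat_rate _ e10.
have [MS S_small] := Sigmahat_rate _ e10.
have bad := eventually_unlikelyU (eventually_unlikelyU (eventually_unlikelyU
  (eventually_unlikelyU (eventually_unlikelyU (eventually_unlikelyU
  slice_size coords) inverse) null) tyler) mu_small) S_small.
have e7 : e1 + e1 + e1 + e1 + e1 + e1 + e1 = e by rewrite /e1; field.
move: bad; rewrite e7; set B := (X in eventually_unlikely P X _) => bad.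
have [c c0 hc] := @inv_sqrtmx_near1 R p.
pose q := frobenius_norm (1%:M : 'M[R]_p).
have q0 : 0 <= q by exact: frobenius_ge0.
exists (2 / pk * (2 * (2 * q * MS + (q + 2 * q * MS) * Mmu * Ki) + \sum_j Kd j)).
near=> n.
have Bn : ((P^* (B n))%mu <= e%:E)%E by near: n; exact: bad.
(* From here on n is so large that n_k is at least half its mean and that the
   scatter matrix is close enough to 1 to have a positive definite root. *)
have r1 : 1 <= Num.sqrt n%:R :> R by near: n; exact: near_sqrt_ge.
have rK : 2 / pk * Kn <= Num.sqrt n%:R :> R by near: n; exact: near_sqrt_ge.
have rc : MS / c <= Num.sqrt n%:R :> R by near: n; exact: near_sqrt_ge.
set r := Num.sqrt n%:R in r1 rK rc *.
have r0 : 0 < r by apply: lt_le_trans r1.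
have r2 : r ^+ 2 = n%:R by rewrite sqr_sqrtr.
(* It suffices to bound the error outside the exceptional event B n. *)
apply: le_trans Bn; apply: le_mu_ext => w /=; apply: contraPP.
rewrite /B /= !not_orE => -[[[[[[]]]]]] /negP.
rewrite -leNgt -/r -bigcup_seq => nk_near coords_w /negP inverse_w null_w /contrapT.
move=> /tyler_limit_sym ST /negP; rewrite -leNgt => mu_w /negP; rewrite -leNgt => S_w.
have /(le_trans S_w)/(hc _ ST)[BT BB B1] : MS / r <= c.
  by rewrite ler_pdivrMr// mulrC -ler_pdivrMr.
have B1r : r * frobenius_norm (inv_sqrtmx (Sigmahat n w) - 1%:M) <= 2 * q * MS.
  rewrite mulrC -ler_pdivlMr// (le_trans B1)// -/q -[leRHS]mulrA.
  by rewrite ler_wpM2l// mulr_ge0.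
apply/negP; rewrite -leNgt.
apply: (slice_mean_rate r0 r2 pk0 rK nk_near) => //.
- move=> j; rewrite leNgt; apply/negP => j_large.
  by apply: coords_w; exists j => //=; exact: mem_enum.
- by move=> i ilt; apply/eqP => xi0; apply: null_w; exists i.
- by rewrite leNgt.
- rewrite -[X in frobenius_norm X](subrK 1%:M) addrC.
  apply: le_trans (frobeniusD _ _) _; rewrite lerD2l (le_trans _ B1r)//.
  by rewrite ler_peMl// frobenius_ge0.
- by rewrite mulrC -ler_pdivlMr.
Unshelve. all: by end_near. Qed.
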